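(* (In ZFC set theory.) For a graph $G$ the following are equivalent: (a) $G$ is a generalized Cayley graph of a left-quasigroup; (b) $G$ is a generalized Cayley graph of a left-quasigroup with a left identity; (c) $G$ is simple, deterministic, source-complete and co-out-regular. Likewise, the following are equivalent: (a') $G$ is a generalized Cayley graph of a left-quasigroup with a right identity; (b') $G$ is a generalized Cayley graph of a left-quasigroup with an identity; (c') $G$ is simple, deterministic, source-complete, loop-complete and co-out-regular.
   Context: A graph is a non-empty set $G\subseteq V\times A\times V$ of labeled edges $s\xrightarrow{a}_G t$; $s\to_G t$ means such an edge exists for some $a$; $V_G$ is the set of vertices occurring in edges, $A_G$ the set of labels. A graph is a generalized Cayley graph of a magma $(M,\cdot)$ if it equals $\mathcal{C}\langle M,Q\rangle=\{(p,\langle q\rangle,p\cdot q): p\in M,\ q\in Q\}$ for some $Q\subseteq M$ and injective $\langle\,\rangle:Q\to A$. A magma is a left-quasigroup if for all $p,q$ there is a unique $r$ with $p\cdot r=q$. Left identity: $e\cdot p=p$ for all $p$; right identity: $p\cdot e=p$ for all $p$; identity: both. $G$ is simple if no two edges share source and target; deterministic if $r\xrightarrow{a}s$, $r\xrightarrow{a}t$ imply $s=t$; source-complete if for every $s\in V_G$, $a\in A_G$ there is $t$ with $s\xrightarrow{a}_G t$; loop-complete if whenever some vertex has an $a$-labeled loop, every vertex has an $a$-labeled loop; co-out-regular if the cardinal $|\{t\in V_G: \text{there is no edge } s\to_G t\}|$ is the same for all $s\in V_G$. *)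

(* Defs.v *)
From mathcomp Require Import all_boot.
From mathcomp Require Import all_classical.

Set Implicit Arguments.
Unset Strict Implicit.
Unset Printing Implicit Defensive.

Local Open Scope classical_set_scope.
Local Open Scope card_scope.

Section Graphs.
Variables (V A : Type).
Implicit Types G : set (V * A * V).

Definition edge G (s : V) (a : A) (t : V) : Prop := G (s, a, t).

Definition adj G (s t : V) : Prop := exists a, edge G s a t.

Definition vertices G : set V := [set s | exists t, adj G s t \/ adj G t s].

Definition labels G : set A := [set a | exists s t, edge G s a t].

Definition simple_graph G : Prop :=
  forall s t a b, edge G s a t -> edge G s b t -> a = b.

Definition deterministic G : Prop :=
  forall r a s t, edge G r a s -> edge G r a t -> s = t.

Definition source_complete G : Prop :=
  forall s a, vertices G s -> labels G a -> exists t, edge G s a t.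

Definition loop_complete G : Prop :=
  forall a, (exists s, edge G s a s) -> forall t, vertices G t -> edge G t a t.

Definition non_successors G (s : V) : set V :=
  [set t | vertices G t /\ ~ adj G s t].

Definition co_out_regular G : Prop :=
  forall s t, vertices G s -> vertices G t ->
    non_successors G s #= non_successors G t.

(* A magma whose elements are vertices is a set [M : set V] with an operation on
   the subtype of its elements.  Graphs are compared by equality and not up to
   isomorphism, so the vertices of a Cayley graph are the elements themselves. *)
Definition cayley (M : set V) (op : M -> M -> M) (Q : set M) (lab : Q -> A) :
    set (V * A * V) :=
  [set e | exists (p : M) (q : Q), e = (val p, lab q, val (op p (val q)))].

Definition generalized_cayley_graph (M : set V) (op : M -> M -> M) G : Prop :=
  exists (Q : set M) (lab : Q -> A), injective lab /\ G = cayley op lab.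

End Graphs.

Definition left_quasigroup (T : Type) (op : T -> T -> T) : Prop :=
  forall p q, exists! r, op p r = q.

(* Main.v *)
Require Import Defs.
From mathcomp Require Import all_boot.
From mathcomp Require Import all_classical.

Set Implicit Arguments.
Unset Strict Implicit.
Unset Printing Implicit Defensive.

Local Open Scope classical_set_scope.

(** Fix a vertex [e] and let [Q] be its set of successors, [q] being labelled as
    the edge from [e] to it. Following the labels, the successors of [e]
    correspond to those of any vertex [p]; as [G] is co-out-regular, this extends
    to a permutation [q |-> p q] of the vertices, taken to be the identity when
    [p = e]. For [e] to be a right identity it remains to have [p e = p]: by
    loop-completeness, composing with the transposition of [p e] and [p] keeps
    the labels. *)

(** Lets a permutation be given by a relation defined by cases: surjectivity and injectivity become
    totality and functionality of the converse relation. *)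
Lemma bijective_of_rel (T U : Type) (R : T -> U -> Prop) :
    (forall x, exists y, R x y) -> (forall y, exists x, R x y) ->
    (forall x y y', R x y -> R x y' -> y = y') ->
    (forall x x' y, R x y -> R x' y -> x = x') ->
  exists f : T -> U, bijective f /\ forall x, R x (f x).
Proof.
move=> /choice[f Rf] /choice[g Rg] Rfun Rinj; exists f; split=> //.
exists g => [x|y]; first exact: Rinj (Rg _) (Rf _).
exact: Rfun (Rf _) (Rg _).
Qed.

Lemma transposition_exists (T : Type) (a b : T) :
  exists s : T -> T,
    [/\ involutive s, s a = b & forall x, x <> a -> x <> b -> s x = x].
Proof.
exists (fun x => if `[< x = a >] then b else if `[< x = b >] then a else x).
split=> [x||x xa xb]; last by rewrite !asboolF.
- case: (asboolP (x = a)) => [->|xa].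
    by case: (asboolP (b = a)) => // _; rewrite asboolT.
  by case: (asboolP (x = b)) => [->|xb]; [rewrite asboolT | rewrite !asboolF].
- by rewrite asboolT.
Qed.

Lemma bijective_left_quasigroup (T : Type) (op : T -> T -> T) :
  (forall p, bijective (op p)) -> left_quasigroup op.
Proof.
move=> opB p q; have [g opK gK] := opB p.
by exists (g q); split=> [|r <-]; rewrite ?gK ?opK.
Qed.

(** * Properties of the Cayley graphs of left-quasigroups *)

Section CayleyGraph.
Variables (V A : Type) (M : set V) (op : M -> M -> M).
Variables (Q : set M) (lab : Q -> A).
Hypotheses (op_lq : left_quasigroup op) (lab_inj : injective lab).
Hypothesis Q0 : Q !=set0.
Let G := cayley op lab.

Lemma left_quasigroup_inj (p : M) : injective (op p).
Proof.
move=> q r qr; have [x [_ xP]] := op_lq p (op p q).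
by rewrite -(xP q erefl) -(xP r (esym qr)).
Qed.

Lemma edge_cayley (p : M) a t :
  edge G (val p) a t <-> exists q : Q, a = lab q /\ t = val (op p (val q)).
Proof.
split=> [[p' [q [/val_inj <- -> ->]]]|[q [-> ->]]]; first by exists q.
by exists p, q.
Qed.

Lemma edge_cayley_source s a t : edge G s a t -> exists p : M, s = val p.
Proof. by move=> [p [q [-> _ _]]]; exists p. Qed.

Lemma adj_cayley (p r : M) : adj G (val p) (val r) <-> exists2 q, Q q & r = op p q.
Proof.
split=> [[a /edge_cayley[q [_ /val_inj->]]]|[q Qq ->]].
  by exists (val q) => //; exact: set_valP.
by exists (lab (SigSub (mem_set Qq))); apply/edge_cayley; exists (SigSub (mem_set Qq)).
Qed.

(** As [Q] has an element, every element of [M] is the source of an edge. *)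
Lemma vertices_cayley : vertices G = M.
Proof.
apply/seteqP; split=> [s [t [[a]|[a]]]|s Ms].
- by move=> /edge_cayley_source[p ->]; exact: set_valP.
- by move=> [p [q [_ _ ->]]]; exact: set_valP.
have [q Qq] := Q0; pose p : M := SigSub (mem_set Ms).
by exists (val (op p q)); left; apply/(@adj_cayley p); exists q.
Qed.

Lemma simple_cayley : simple_graph G.
Proof.
move=> s t a b st; have [p sE] := edge_cayley_source st; move: st; rewrite {s}sE.
move=> /edge_cayley[q [-> ->]] /edge_cayley[r [-> /val_inj]].
by move=> /left_quasigroup_inj/val_inj->.
Qed.

Lemma deterministic_cayley : deterministic G.
Proof.
move=> s a t u st; have [p sE] := edge_cayley_source st; move: st; rewrite {s}sE.
by move=> /edge_cayley[q [-> ->]] /edge_cayley[r [/lab_inj <- ->]].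
Qed.

Lemma source_complete_cayley : source_complete G.
Proof.
move=> s a; rewrite vertices_cayley => Ms [s' [t [p [q [_ -> _]]]]].
pose s0 : M := SigSub (mem_set Ms).
by exists (val (op s0 (val q))); apply/(@edge_cayley s0); exists q.
Qed.

(** Left translation by [p] is a bijection taking [Q] to the successors of [p], hence the complement
    of [Q] to the non-successors. The cardinal of the latter is therefore independent of [p]. *)
Lemma non_successors_cayley (p : M) :
  non_successors G (val p) = (fun q => val (op p q)) @` (~` Q).
Proof.
apply/seteqP; split=> [t []|_ [q nQq <-]].
  rewrite vertices_cayley => Mt npt; have [q [qE _]] := op_lq p (SigSub (mem_set Mt)).
  exists q; last by rewrite qE.
  move=> Qq; apply: npt; apply/(@adj_cayley p (SigSub (mem_set Mt))).
  by exists q.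
split; first by rewrite vertices_cayley; exact: set_valP.
by move=> /adj_cayley[r Qr /left_quasigroup_inj qr]; apply: nQq; rewrite qr.
Qed.

Lemma co_out_regular_cayley : co_out_regular G.
Proof.
suff nsE (p : M) : (non_successors G (val p) #= ~` Q)%card.
  rewrite /co_out_regular vertices_cayley => s t Ms Mt.
  have := nsE (SigSub (mem_set Mt)); rewrite card_eq_sym.
  exact: card_eq_trans (nsE (SigSub (mem_set Ms))).
rewrite non_successors_cayley; apply: inj_card_eq => q r _ _.
by move=> /val_inj/left_quasigroup_inj.
Qed.

(** A loop at [p] labelled by [q] gives [op p q = p = op p e], so [q = e] by left cancellation, and
    [e] labels a loop at every vertex. *)
Lemma loop_complete_cayley (e : M) : right_id e op -> loop_complete G.
Proof.
move=> opre a [s ss] t; rewrite vertices_cayley => Mt.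
have [p sE] := edge_cayley_source ss; move: ss; rewrite {s}sE => /edge_cayley.
move=> [q [-> /val_inj]]; rewrite -[LHS]opre => /left_quasigroup_inj eq.
pose t0 : M := SigSub (mem_set Mt).
by apply/(@edge_cayley t0); exists q; split; rewrite // -eq opre.
Qed.

End CayleyGraph.

Lemma left_quasigroup_cayley_graph (V A : Type) (G : set (V * A * V)) (M : set V)
    (op : M -> M -> M) :
    G !=set0 -> left_quasigroup op -> generalized_cayley_graph op G ->
  [/\ simple_graph G, deterministic G, source_complete G, co_out_regular G
    & forall e, right_id e op -> loop_complete G].
Proof.
move=> G0 op_lq [Q [lab [lab_inj GE]]].
have Q0 : Q !=set0.
  by move: G0; rewrite GE => -[_ [p [q _]]]; exists (val q); exact: set_valP.
rewrite GE; split.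
- exact: simple_cayley.
- exact: deterministic_cayley.
- exact: source_complete_cayley.
- exact: co_out_regular_cayley.
- by move=> e; exact: loop_complete_cayley.
Qed.

(** * Construction of a left-quasigroup from a graph *)

Section Construction.
Variables (V A : Type) (G : set (V * A * V)).
Hypotheses (G_simple : simple_graph G) (G_det : deterministic G).
Hypotheses (G_sc : source_complete G) (G_cor : co_out_regular G).
Let M := vertices G.

Lemma edge_vertices s a t : edge G s a t -> [/\ M s, labels G a & M t].
Proof.
by move=> st; split; [exists t; left; exists a | exists s, t | exists s; right; exists a].
Qed.

(** The graph of the translation [q |-> p q]. The relation [B] stands for a bijection between the
    non-successors of [e] and those of [p]. *)
Definition translation_rel (B : V -> V -> Prop) (e p q r : V) : Prop :=
  (exists a, edge G e a q /\ edge G p a r) \/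
  [/\ ~ adj G e q, ~ adj G p r & B q r].

Lemma translation_rel_total B e p : M p ->
    (forall q, non_successors G e q -> exists2 r, non_successors G p r & B q r) ->
  forall q, M q -> exists2 r, M r & translation_rel B e p q r.
Proof.
move=> Mp Btot q Mq; have [[a eq]|neq] := pselect (adj G e q).
  have [_ la _] := edge_vertices eq; have [r pr] := G_sc Mp la.
  by exists r; [have [] := edge_vertices pr | left; exists a].
by have [r [Mr npr] Bqr] := Btot _ (conj Mq neq); exists r => //; right.
Qed.

(** Adjacency of [e] and [q] decides which clause applies. In the first, simplicity makes the label
    unique and determinism then the target. *)
Lemma translation_rel_functional B e p :
    (forall q r r', B q r -> B q r' -> r = r') ->
  forall q r r',
    translation_rel B e p q r -> translation_rel B e p q r' -> r = r'.
Proof.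
move=> Bfun q r r' [[a [ea pa]]|[neq _ Br]] [[b [eb pb]]|[neq' _ Br']].
- by move: pb; rewrite -(G_simple ea eb); exact: G_det.
- by case: neq'; exists a.
- by case: neq; exists b.
- exact: Bfun Br Br'.
Qed.

(** By this symmetry, surjectivity and injectivity of the translation reduce to the two preceding
    lemmas with [e] and [p] exchanged. *)
Lemma translation_rel_sym B e p q r :
  translation_rel B e p q r <-> translation_rel (fun x y => B y x) p e r q.
Proof.
by split=> -[[a []]|[]]; by [left; exists a | right].
Qed.

Lemma translation_exists (e p : M) :
  exists f : M -> M, bijective f /\
    forall a q, edge G (val e) a (val q) -> edge G (val p) a (val (f q)).
Proof.
have [h [k hK kK]] := card_bijP (G_cor (set_valP e) (set_valP p)).
(* The graph of [h], carried from the subtypes of non-successors to [V]. *)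
pose B x y := exists z, val z = x /\ val (h z) = y.
have [||||f [fB fP]] := @bijective_of_rel M M
    (fun q r => translation_rel B (val e) (val p) (val q) (val r)).
- move=> q.
  have [|r Mr ?] := @translation_rel_total B (val e) _ (set_valP p) _ _ (set_valP q).
    move=> x xe; exists (val (h (SigSub (mem_set xe)))); first exact: set_valP.
    by exists (SigSub (mem_set xe)).
  by exists (SigSub (mem_set Mr)).
- move=> r.
  have [|q Mq ?] :=
    @translation_rel_total (fun x y => B y x) (val p) _ (set_valP e) _ _ (set_valP r).
    move=> x xp; exists (val (k (SigSub (mem_set xp)))); first exact: set_valP.
    by exists (k (SigSub (mem_set xp))); rewrite kK.
  by exists (SigSub (mem_set Mq)); apply/translation_rel_sym.
- move=> q r r' qr qr'; apply: val_inj; apply: translation_rel_functional qr qr'.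
  by move=> x y y' [z [<- <-]] [z' [/val_inj -> <-]].
- move=> q q' r /translation_rel_sym qr /translation_rel_sym q'r.
  apply: val_inj; apply: translation_rel_functional qr q'r.
  by move=> x y y' [z [<- <-]] [z' [<- /val_inj/(can_inj hK) ->]].
exists f; split=> // a q eq; have [[b [eb pb]]|[]] := fP q; last by case; exists a.
by rewrite (G_simple eq eb).
Qed.

Lemma pointed_translation_exists (e p : M) :
  exists f : M -> M, [/\ bijective f,
    forall a q, edge G (val e) a (val q) -> edge G (val p) a (val (f q)),
    p = e -> f = id
    & loop_complete G -> f e = p].
Proof.
have [->|pe] := pselect (p = e); first by exists id; split=> //; exists id.
have [f [fB fP]] := translation_exists e p.
(* Without loop-completeness the last requirement is vacuous and [f] itself will do. *)
have [lc|nlc] := pselect (loop_complete G); last by exists f.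
have [s [sK sfe sid]] := transposition_exists (f e) p.
exists (s \o f); split=> //=; first exact: bij_comp (inv_bij sK) fB.
move=> a q eq.
(* Only the values [f e] and [p] are moved. If [f q = f e], then [q = e], so [a] labels a loop at
   [e] and hence one at [p], the new value. *)
have [fqe|fqe] := pselect (f q = f e).
  rewrite fqe sfe; apply: lc (set_valP p); exists (val e).
  by move: eq; rewrite (bij_inj fB fqe).
have [fqp|fqp] := pselect (f q = p); last by rewrite sid //; exact: fP.
(* If [f q = p], then [a] labels a loop at [p], hence at [e]. Determinism gives [q = e], which
   contradicts [fqe]. *)
have ee : edge G (val e) a (val e).
  by apply: lc (set_valP e); exists (val p); have := fP _ _ eq; rewrite fqp.
by case: fqe; rewrite (val_inj (G_det eq ee)).
Qed.

Lemma cayley_graph_left_quasigroup (e : M) :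
  exists op : M -> M -> M,
    [/\ left_quasigroup op, left_id e op, generalized_cayley_graph op G
      & loop_complete G -> right_id e op].
Proof.
have [op opP] := choice (pointed_translation_exists e).
exists op; split.
- by apply: bijective_left_quasigroup => p; have [] := opP p.
- by move=> q; have [_ _ -> ] := opP e.
- pose Q : set M := [set q | adj G (val e) (val q)].
  have /choice[lab labP] (q : Q) : exists a, edge G (val e) a (val (val q)).
    exact: set_valP q.
  exists Q, lab; split.
    move=> q r qr; apply/val_inj/val_inj; apply: G_det (labP q) _.
    by rewrite qr; exact: labP.
  have opE (p : M) (q : Q) : edge G (val p) (lab q) (val (op p (val q))).
    by have [_ + _ _] := opP p; apply; exact: labP.
  apply/seteqP; split=> [[[s a] t] st|_ [p [q ->]]]; last exact: opE.
  (* By source-completeness the label [a] also occurs at [e], and the target of that edge is the [q]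
     sought. Simplicity identifies [a] with [lab q], and determinism [t] with [op p q]. *)
  have [Ms la _] := edge_vertices st; have [q0 eq0] := G_sc (set_valP e) la.
  have [_ _ Mq] := edge_vertices eq0.
  have Qq : Q (SigSub (mem_set Mq)) by exists a.
  pose p : M := SigSub (mem_set Ms); pose q : Q := SigSub (mem_set Qq).
  have aE : a = lab q by exact: G_simple eq0 (labP q).
  exists p, q; rewrite -aE; congr (_, _, _).
  by apply: (G_det st); rewrite aE; exact: (opE p q).
- by move=> lc p; have [_ _ _ ->] := opP p.
Qed.

End Construction.

Theorem theorem6p5 (V A : Type) (G : set (V * A * V)) (hG : G !=set0) :
  [<-> exists (M : set V) (op : M -> M -> M),
         left_quasigroup op /\ generalized_cayley_graph op G;
       exists (M : set V) (op : M -> M -> M),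
         [/\ left_quasigroup op, (exists e : M, left_id e op)
           & generalized_cayley_graph op G];
       [/\ simple_graph G, deterministic G, source_complete G
         & co_out_regular G] ] /\
  [<-> exists (M : set V) (op : M -> M -> M),
         [/\ left_quasigroup op, (exists e : M, right_id e op)
           & generalized_cayley_graph op G];
       exists (M : set V) (op : M -> M -> M),
         [/\ left_quasigroup op,
             (exists e : M, left_id e op /\ right_id e op)
           & generalized_cayley_graph op G];
       [/\ simple_graph G, deterministic G, source_complete G,
           loop_complete G & co_out_regular G] ].
Proof.
have [[[s a] t] st] := hG.
have [Ms _ _] := edge_vertices st.
(* The source of any edge serves as the distinguished vertex [e]. *)
have construct := fun g1 g2 g3 g4 =>
  @cayley_graph_left_quasigroup V A G g1 g2 g3 g4 (SigSub (mem_set Ms)).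
split; tfae.
(* The given operation may lack a left identity, so a new one is built from the properties of its
   Cayley graph. *)
- move=> [M [op [lq gc]]].
  have [g1 g2 g3 g4 _] := left_quasigroup_cayley_graph hG lq gc.
  have [op' [lq' le gc' _]] := construct g1 g2 g3 g4.
  by exists (vertices G), op'; split=> //; eexists; exact: le.
- by move=> [M [op [lq _ gc]]]; have [] := left_quasigroup_cayley_graph hG lq gc.
- move=> [g1 g2 g3 g4]; have [op [lq _ gc _]] := construct g1 g2 g3 g4.
  by exists (vertices G), op.
- move=> [M [op [lq [e re] gc]]].
  have [g1 g2 g3 g4 /(_ e re) lc] := left_quasigroup_cayley_graph hG lq gc.
  have [op' [lq' le gc' /(_ lc) re']] := construct g1 g2 g3 g4.
  by exists (vertices G), op'; split=> //; eexists; split; [exact: le | exact: re'].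
- move=> [M [op [lq [e [_ re]] gc]]].
  by have [g1 g2 g3 g4 /(_ e re) lc] := left_quasigroup_cayley_graph hG lq gc.
- move=> [g1 g2 g3 lc g4]; have [op [lq _ gc /(_ lc) re]] := construct g1 g2 g3 g4.
  by exists (vertices G), op; split=> //; eexists; exact: re.
Qed.
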